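(* Given a directed graph $G$, a set $S\subseteq E(G)$, a positive integer $k$, and a fixed non-empty set $T_0\subseteq V(G)$, one can find in time $O^{*}(2^{O(k)})$ a set $F_{T_0}\subseteq V(G)$ of $2^{O(k)}$ vertices that contains every $k$-critical vertex with respect to $T_0$.
   Context: $O^*(\cdot)$ hides polynomial factors in the input size. Let $S^{-}=\{u:(u,v)\in S\}$ and $S^{+}=\{v:(u,v)\in S\}$. For a set $X\subseteq V(G)$, an edge $(u,v)\in S$ is traversable from $T_0$ in $G\setminus X$ if $u,v\notin X$ and $u$ is reachable from $T_0$ in $G\setminus X$. A vertex $v\in (V(G)\setminus T_0)\cap S^{+}$ is $\ell$-critical with respect to $T_0$ if there exist an edge $(u,v)\in S$ and a set $W\subseteq V(G)\setminus T_0$ such that $|W|\le\ell$, $v\in W$, $u$ is reachable from $T_0$ in $G\setminus W$, and no edge of $S$ is traversable from $T_0$ in $G\setminus W$. *)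

(* Defs.v *)
From HB Require Import structures.
From mathcomp Require Import all_boot.

Set Implicit Arguments.
Unset Strict Implicit.
Unset Printing Implicit Defensive.

(* A digraph on V is its edge set E; loops are allowed. *)
Section Digraph.

Variables (V : finType) (E : {set V * V}).

(* The edge relation of G \ X. *)
Definition del_rel (X : {set V}) : rel V :=
  [rel x y | [&& x \notin X, y \notin X & (x, y) \in E]].

Definition reachable (T0 X : {set V}) (u : V) : Prop :=
  exists2 t, t \in T0 :\: X & connect (del_rel X) t u.

Definition traversable (T0 X : {set V}) (e : V * V) : Prop :=
  [/\ e.1 \notin X, e.2 \notin X & reachable T0 X e.1].

Definition heads (S : {set V * V}) : {set V} := [set e.2 | e in S].

Definition critical (S : {set V * V}) (T0 : {set V}) (l : nat) (v : V) : Prop :=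
  v \in ~: T0 :&: heads S /\
  exists (u : V) (W : {set V}),
    [/\ (u, v) \in S, W \subset ~: T0, #|W| <= l & v \in W] /\
    reachable T0 W u /\ (forall e, e \in S -> ~ traversable T0 W e).

End Digraph.

(* Model of computation: first-order recursive programs over binary trees
   (the LISP-like language F of Jones, "Computability and Complexity from a
   Programming Perspective"), every evaluation step having unit cost.  Values
   are immutable, so they are shared by pointers and each step is elementary;
   time in this model is polynomially related to Turing machine time. *)
Inductive tree : Type := Leaf | Node of tree & tree.

(* De Bruijn indices: [ELet] binds one variable in its second argument; the
   [Node] branch of [ECase] binds the left subtree as 0, the right one as 1. *)
Inductive expr : Type :=
| EVar of nat
| ELeaf
| ENode of expr & expr
| ELet of expr & expr
| ECase of expr & expr & expr
| ECall of nat & expr.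

(* The i-th expression is the body of function i, whose unique parameter is
   variable 0; the bodies may be mutually recursive. *)
Definition program := seq expr.

Definition body (P : program) (f : nat) : expr := nth ELeaf P f.

(* [eval P rho e v t]: in environment rho, e terminates with value v after
   exactly t steps. *)
Inductive eval (P : program) : seq tree -> expr -> tree -> nat -> Prop :=
| eval_var rho i : eval P rho (EVar i) (nth Leaf rho i) 1
| eval_leaf rho : eval P rho ELeaf Leaf 1
| eval_node rho e1 e2 v1 v2 t1 t2 :
    eval P rho e1 v1 t1 -> eval P rho e2 v2 t2 ->
    eval P rho (ENode e1 e2) (Node v1 v2) (t1 + t2).+1
| eval_let rho e1 e2 v1 v2 t1 t2 :
    eval P rho e1 v1 t1 -> eval P (v1 :: rho) e2 v2 t2 ->
    eval P rho (ELet e1 e2) v2 (t1 + t2).+1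
| eval_case_leaf rho e e1 e2 v t1 t2 :
    eval P rho e Leaf t1 -> eval P rho e1 v t2 ->
    eval P rho (ECase e e1 e2) v (t1 + t2).+1
| eval_case_node rho e e1 e2 vl vr v t1 t2 :
    eval P rho e (Node vl vr) t1 -> eval P (vl :: vr :: rho) e2 v t2 ->
    eval P rho (ECase e e1 e2) v (t1 + t2).+1
| eval_call rho f e v1 v2 t1 t2 :
    eval P rho e v1 t1 -> eval P [:: v1] (body P f) v2 t2 ->
    eval P rho (ECall f e) v2 (t1 + t2).+1.

Lemma eval_det P rho e v t v' t' :
  eval P rho e v t -> eval P rho e v' t' -> v = v' /\ t = t'.
Proof.
move=> ev; elim: ev v' t' => {rho e v t}
  [rho i|rho|rho e1 e2 v1 v2 t1 t2 _ IH1 _ IH2|rho e1 e2 v1 v2 t1 t2 _ IH1 _ IH2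
  |rho e e1 e2 v t1 t2 _ IH1 _ IH2|rho e e1 e2 vl vr v t1 t2 _ IH1 _ IH2
  |rho f e v1 v2 t1 t2 _ IH1 _ IH2] v' t' ev';
  inversion ev'; subst => //;
  match goal with H : eval _ _ _ _ _ |- _ => case: (IH1 _ _ H) => ? ? end;
  subst => //;
  try match goal with H : Node _ _ = Node _ _ |- _ => case: H => ? ?; subst end;
  match goal with H : eval _ _ _ _ _ |- _ => case: (IH2 _ _ H) => ? ? end;
  by subst.
Qed.

Definition runs (P : program) (x y : tree) (t : nat) : Prop :=
  eval P [:: x] (body P 0) y t.

Fixpoint enc_seq (T : Type) (enc : T -> tree) (s : seq T) : tree :=
  if s is a :: s' then Node (enc a) (enc_seq enc s') else Leaf.

Definition enc_nat (n : nat) : tree := iter n (Node Leaf) Leaf.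

Definition enc_vertex (V : finType) (v : V) : tree := enc_nat (enum_rank v).

Definition enc_edge (V : finType) (e : V * V) : tree :=
  Node (enc_vertex e.1) (enc_vertex e.2).

Definition enc_input (V : finType) (E S : {set V * V}) (k : nat)
    (T0 : {set V}) : tree :=
  Node (enc_nat #|V|)
    (Node (enc_seq (@enc_edge V) (enum E))
      (Node (enc_seq (@enc_edge V) (enum S))
        (Node (enc_nat k) (enc_seq (@enc_vertex V) (enum T0))))).

(* y is a duplicate-free list, in any order, of the elements of F. *)
Definition represents (V : finType) (y : tree) (F : {set V}) : Prop :=
  exists s : seq V, [/\ uniq s, s =i F & y = enc_seq (@enc_vertex V) s].

(* Main.v *)
(* Split every vertex into copies so that deleting it, or paying for it being the
   head of an edge of S that leaves the reached region, each cuts one edge.  If W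
   witnesses that v is k-critical, the region reached from T0 in G \ W becomes a
   set R with at most 2k outgoing edges, one of which leads into v; and the same
   holds for every larger set of the same kind that avoids the sinks.  So it is
   enough to list 2^O(k) sets of cut value at most p = 2k such that each R is
   contained in one of them, i.e. the important cuts.

   They are found by branching on A <= R and R disjoint from B in a residual
   network.  Reversing a path from A to B lowers every cut separating A from B by
   one, which can happen at most p times.  Once no path is left, the set Q
   reachable from A has no outgoing residual edge, so R may be enlarged by Q.
   Then an original edge (x,y) leaves Q for some y outside B, or Q itself is
   listed.  If adding y to Q creates no residual path to B, the closure of Q + y is
   again harmless; otherwise branch: y in R allows one more reversal, and y not in R
   puts (x,y) in the cut.  Both budgets are p, whence at most 2^(2p) sets. *)
From HB Require Import structures.
Require Import Defs.
From mathcomp Require Import all_boot.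
From mathcomp Require Import zify.

Set Implicit Arguments.
Unset Strict Implicit.
Unset Printing Implicit Defensive.

(** * Trees as data: equality, size, and edge lists with their cuts *)

Fixpoint tree_eqb (a b : tree) : bool :=
  match a, b with
  | Leaf, Leaf => true
  | Node a1 a2, Node b1 b2 => tree_eqb a1 b1 && tree_eqb a2 b2
  | _, _ => false
  end.

Lemma tree_eqbP : Equality.axiom tree_eqb.
Proof.
elim=> [|a1 IH1 a2 IH2] [|b1 b2]; try by constructor.
by apply: (iffP andP) => [[/IH1 -> /IH2 ->]|[<- <-]] //; split; [apply/IH1|apply/IH2].
Qed.

HB.instance Definition _ := hasDecEq.Build tree tree_eqbP.

Fixpoint tree_size (a : tree) : nat :=
  if a is Node a1 a2 then (tree_size a1 + tree_size a2).+1 else 1.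

Local Notation edge := (tree * tree)%type.

Definition enc_pair (e : edge) : tree := Node e.1 e.2.
Local Notation enc_pairs := (enc_seq enc_pair).
Local Notation enc_trees := (enc_seq (@id tree)).
Definition enc_bool (b : bool) : tree := if b then Node Leaf Leaf else Leaf.

Definition cut (L : seq edge) (R : pred tree) : nat :=
  count (fun e => R e.1 && ~~ R e.2) L.

Definition keys (s : seq edge) : seq tree := [seq e.1 | e <- s].

(** * The program *)

Local Notation v0 := (EVar 0).
Local Notation v1 := (EVar 1).
Local Notation v2 := (EVar 2).
Local Notation v3 := (EVar 3).
Local Notation v4 := (EVar 4).
Local Notation v5 := (EVar 5).
Local Notation v6 := (EVar 6).
Local Notation v7 := (EVar 7).
Local Notation v8 := (EVar 8).
Local Notation v9 := (EVar 9).
Local Notation v10 := (EVar 10).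
Local Notation ETrue := (ENode ELeaf ELeaf).
Local Notation tag1 := (ENode ELeaf ELeaf).
Local Notation tag2 := (ENode ELeaf tag1).
Local Notation tag3 := (ENode ELeaf tag2).

Local Notation Feq := 1.
Local Notation Flookup := 2.
Local Notation Fswap := 3.
Local Notation Fext := 4.
Local Notation Fsearch := 5.
Local Notation Finit := 6.
Local Notation Fpick := 7.
Local Notation Finsert := 8.
Local Notation Fout := 9.
Local Notation Fgo := 10.
Local Notation Fmk := 11.
Local Notation FmkV := 12.
Local Notation FmkB := 13.
Local Notation FmkA := 14.
Local Notation Fdbl := 15.

Definition eq_body : expr :=
  ECase v0 ELeaf
   (ECase v0
     (ECase v1 ETrue ELeaf)
     (ECase v3 ELeaf
       (ECase (ECall Feq (ENode v2 v0)) ELeaf (ECall Feq (ENode v5 v3))))).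

Definition lookup_body : expr :=
  ECase v0 ELeaf
   (ECase v1 ELeaf
     (ECase v0 ELeaf
       (ECase (ECall Feq (ENode v4 v0))
         (ECall Flookup (ENode v4 v3))
         v4))).

Definition swap_body : expr :=
  ECase v0 ELeaf
   (ECase v1 ELeaf
     (ECase (ECall Feq (ENode v2 v0))
       (ENode v0 (ECall Fswap (ENode v2 v1)))
       (ECase v4 ELeaf (ENode (ENode v1 v0) v5)))).

(** Finds the edge along which the search proceeds, from a visited tail to an unvisited head. The
    answer pairs this head with the network stored at the tail, in which the edge has been reversed
    as well. *)
Definition ext_body : expr :=
  ECase v0 ELeaf
   (ECase v1 ELeaf
     (ECase v0 ELeaf
       (ECase (ECall Flookup (ENode v0 v4))
         (ECall Fext (ENode v4 v3))
         (ECase (ECall Flookup (ENode v3 v6))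
           (ENode v3 (ECall Fswap (ENode v4 v1)))
           (ECall Fext (ENode v8 v7)))))).

(* A list of pairs (key, value) serves as a finite map.  In the map of visited
   nodes, the value at [z] is the network in which a path from a source to [z] has
   been reversed; the result is tagged [Leaf] for a closed set of visited nodes and
   [Node Leaf Leaf] for the network with a path to a sink reversed. *)
Definition search_body : expr :=
  ECase v0 ELeaf
   (ECase v1 ELeaf
     (ECase (ECall Fext (ENode v2 v0))
       (ENode ELeaf v2)
       (ECase (ECall Flookup (ENode v0 v3))
         (ECall Fsearch (ENode (ENode (ENode v0 v1) v4) v5))
         (ENode ETrue v3)))).

Definition init_body : expr :=
  ECase v0 ELeaf
   (ECase v0 ELeaf
     (ECase v0 ELeaf
       (ENode (ENode v0 v5) (ECall Finit (ENode v3 v5))))).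

(** Looks for an original edge from the closed set [Q] to a node outside both [Q] and [B], along
    which [Q] can grow. *)
Definition pick_body : expr :=
  ECase v0 ELeaf
   (ECase v1 ELeaf
     (ECase v1 ELeaf
       (ECase v0 ELeaf
         (ECase (ECall Flookup (ENode v0 v6))
           (ECall Fpick (ENode v6 (ENode v4 v3)))
           (ECase (ECall Flookup (ENode v3 v8))
             (ECase (ECall Flookup (ENode v3 v6))
               v4
               (ECall Fpick (ENode v10 (ENode v8 v7))))
             (ECall Fpick (ENode v10 (ENode v8 v7)))))))).

Definition insert_body : expr :=
  ECase v0 ELeaf
   (ECase v1 (ENode v0 ELeaf)
     (ECase (ECall Feq (ENode v2 v0))
       (ENode v0 (ECall Finsert (ENode v2 v1)))
       v5)).

(** Lists a cut through the vertices it concerns: the first component of the head of each edge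
    leaving [Q] joins the accumulator. *)
Definition out_body : expr :=
  ECase v0 ELeaf
   (ECase v1 ELeaf
     (ECase v0 v1
       (ECase v0 ELeaf
         (ECase (ECall Flookup (ENode v0 v6))
           (ECall Fout (ENode v6 (ENode v3 v5)))
           (ECase (ECall Flookup (ENode v3 v8))
             (ECase v3 ELeaf
               (ECall Fout (ENode v10 (ENode v7 (ECall Finsert (ENode v0 v9))))))
             (ECall Fout (ENode v10 (ENode v7 v9)))))))).

(* For the argument see [go_input], for the meaning of its components [state]. *)
Definition go_body : expr :=
  ECase v0 ELeaf (ECase v1 ELeaf (ECase v1 ELeaf (ECase v1 ELeaf
  (ECase v1 ELeaf (ECase v1 ELeaf (ECase v1 ELeaf
   (ECase (ECall Fsearch (ENode (ECall Finit (ENode v10 v6)) (ENode v6 v8))) ELeaf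
     (ECase v0
       (ECase (ECall Fpick (ENode v1 (ENode v10 v3)))
         (ECall Fout (ENode v1 (ENode v3 v2)))
         (ECall Fgo (ENode ETrue (ENode (ENode (ENode v1 ELeaf) v3)
           (ENode (EVar 12) (ENode v10 (ENode v8 (ENode v6 (ENode v4 v5)))))))))
       (ELet
         (ECase v8 v4
           (ECall Fgo (ENode ELeaf (ENode (EVar 16) (ENode (EVar 14)
             (ENode v5 (ENode v1 (ENode v8 (ENode v6 v7)))))))))
         (ECase (EVar 17) v0
           (ECase v9 v2
             (ECase (EVar 19) ELeaf
               (ECall Fgo (ENode ELeaf (ENode v1 (ENode (ENode v0 (EVar 19))
                 (ENode (EVar 17) (ENode (EVar 15) (ENode v3
                   (ENode v6 (EVar 12))))))))))))))))))))).

(* For the functions building the input of [go_body] see [copy], [arcs],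
   [vertex_arcs] and [marked]. *)
Definition mk_body : expr :=
  ECase v0 ELeaf
   (ECase v1 ELeaf
     (ECase v0 v1
       (ECase v0 ELeaf
         (ENode (ENode (ENode v0 ELeaf) (ENode v1 v6))
           (ECall Fmk (ENode v6 (ENode v3 v5))))))).

Definition mkV_body : expr :=
  ECase v0 ELeaf
   (ENode (ENode (ENode v1 tag1) (ENode v1 ELeaf))
     (ENode (ENode (ENode v1 tag2) (ENode v1 tag3)) (ECall FmkV v1))).

Definition mkB_body : expr :=
  ECase v0 ELeaf (ENode (ENode (ENode v1 tag3) ELeaf) (ECall FmkB v1)).

Definition mkA_body : expr :=
  ECase v0 ELeaf (ENode (ENode (ENode v0 ELeaf) ELeaf) (ECall FmkA v1)).

Definition dbl_body : expr :=
  ECase v0 ELeaf (ENode ELeaf (ENode ELeaf (ECall Fdbl v1))).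

Definition main_body : expr :=
  ECase v0 ELeaf (ECase v1 ELeaf (ECase v1 ELeaf (ECase v1 ELeaf
   (ELet (ECall Fmk (ENode tag1 (ENode v4
            (ECall Fmk (ENode tag2 (ENode v2 (ECall FmkV v6)))))))
     (ELet (ECall Fdbl v1)
       (ECall Fgo (ENode ELeaf (ENode (ECall FmkA v3) (ENode (ECall FmkB v8)
         (ENode v1 (ENode v0 (ENode v0 (ENode ELeaf v1))))))))))))).

Definition prog : program :=
  [:: main_body; eq_body; lookup_body; swap_body; ext_body; search_body;
      init_body; pick_body; insert_body; out_body; go_body; mk_body; mkV_body;
      mkB_body; mkA_body; dbl_body].

(** * Bounded evaluation *)

(** An upper bound instead of an exact time lets costs be added and weakened freely. *)
Definition evl (rho : seq tree) (e : expr) (v : tree) (T : nat) : Prop :=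
  exists2 t, t <= T & eval prog rho e v t.

Definition computes (f : nat) (x y : tree) (T : nat) : Prop :=
  evl [:: x] (body prog f) y T.

Lemma evl_le rho e v v' T T' :
  evl rho e v T -> v = v' -> T <= T' -> evl rho e v' T'.
Proof. by move=> [t le_t ev] <- leT; exists t => //; apply: leq_trans leT. Qed.

Lemma evl_var rho i : evl rho (EVar i) (nth Leaf rho i) 1.
Proof. by exists 1 => //; constructor. Qed.

Lemma evl_leaf rho : evl rho ELeaf Leaf 1.
Proof. by exists 1 => //; constructor. Qed.

Lemma evl_node rho e1 e2 w1 w2 T1 T2 :
  evl rho e1 w1 T1 -> evl rho e2 w2 T2 ->
  evl rho (ENode e1 e2) (Node w1 w2) (T1 + T2).+1.
Proof.
move=> [t1 le1 ev1] [t2 le2 ev2]; exists (t1 + t2).+1; first by lia.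
exact: eval_node.
Qed.

Lemma evl_let rho e1 e2 w1 w2 T1 T2 :
  evl rho e1 w1 T1 -> evl (w1 :: rho) e2 w2 T2 ->
  evl rho (ELet e1 e2) w2 (T1 + T2).+1.
Proof.
move=> [t1 le1 ev1] [t2 le2 ev2]; exists (t1 + t2).+1; first by lia.
exact: eval_let ev1 ev2.
Qed.

Lemma evl_case rho e e1 e2 w v T1 T2 :
  evl rho e w T1 ->
  match w with
  | Leaf => evl rho e1 v T2
  | Node l r => evl (l :: r :: rho) e2 v T2
  end ->
  evl rho (ECase e e1 e2) v (T1 + T2).+1.
Proof.
move=> [t1 le1 ev1]; case: w ev1 => [|l r] ev1 [t2 le2 ev2];
  exists (t1 + t2).+1; try lia.
- exact: eval_case_leaf ev1 ev2.
- exact: eval_case_node ev1 ev2.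
Qed.

Lemma evl_call rho f e x y T1 T2 :
  evl rho e x T1 -> computes f x y T2 -> evl rho (ECall f e) y (T1 + T2).+1.
Proof.
move=> [t1 le1 ev1] [t2 le2 ev2]; exists (t1 + t2).+1; first by lia.
exact: eval_call ev1 ev2.
Qed.

Ltac evl_step :=
  cbn [nth enc_bool enc_seq enc_pair fst snd];
  lazymatch goal with
  | |- evl _ (EVar _) _ _ => apply: evl_var
  | |- evl _ ELeaf _ _ => apply: evl_leaf
  | |- evl _ (ENode _ _) _ _ => eapply evl_node; [evl_step|evl_step]
  | |- evl _ (ELet _ _) _ _ => eapply evl_let; [evl_step|evl_step]
  | |- evl _ (ECase _ _ _) _ _ => eapply evl_case; [evl_step|evl_step]
  | |- evl _ (ECall _ _) _ _ =>
      eapply evl_call; [evl_step|cbn [nth enc_seq enc_pair fst snd]; eassumption]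
  | |- _ => idtac
  end.

(* Executes a function body, the calls being looked up in the context; what
   remains is to compare the values and the running times. *)
Ltac run b := rewrite /computes; eapply evl_le;
  [ cbn [nth body prog]; rewrite /b; evl_step
  | cbn [nth enc_seq enc_pair fst snd]; try reflexivity
  | cbn [size tree_size enc_pair fst snd]].

(** * Equality tests, finite maps and the reversal of an edge *)

Lemma eq_computes a b :
  computes Feq (Node a b) (enc_bool (a == b)) (20 * tree_size a).
Proof.
elim: a b => [|a1 IH1 a2 IH2] [|b1 b2].
- run eq_body; lia.
- run eq_body; lia.
- run eq_body; lia.
- have := IH1 b1; have := IH2 b2.
  have -> : (Node a1 a2 == Node b1 b2) = (a1 == b1) && (a2 == b2) by [].
  case: (a1 == b1) => /= H2 H1; run eq_body; lia.
Qed.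

(** Returning the whole pair keeps [Leaf] as an unambiguous sign of absence, even when the stored
    value is [Leaf]. *)
Fixpoint lookup (x : tree) (s : seq edge) : tree :=
  if s is e :: s' then if x == e.1 then enc_pair e else lookup x s' else Leaf.

Lemma lookup_computes x s :
  computes Flookup (Node x (enc_pairs s)) (lookup x s)
    ((20 * tree_size x + 30) * (size s).+1).
Proof.
elim: s => [|[k w] s IH] /=; first by run lookup_body; lia.
have := eq_computes x k; case: (x == k) => H; run lookup_body; lia.
Qed.

Lemma mem_keys x w (s : seq edge) : (x, w) \in s -> x \in keys s.
Proof. exact: (@map_f _ _ fst). Qed.

Variant lookup_spec (x : tree) (s : seq edge) : tree -> Type :=
| LookupSome w of (x, w) \in s : lookup_spec x s (Node x w)
| LookupNone of x \notin keys s : lookup_spec x s Leaf.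

Lemma lookupP x s : lookup_spec x s (lookup x s).
Proof.
elim: s => [|[k w] s IH] /=; first by constructor.
case: eqP => [->|/eqP ne] /=; first by constructor; rewrite mem_head.
case: IH => [w' in_s|Nin_s]; constructor; rewrite inE ?in_s ?orbT //.
by rewrite negb_or ne.
Qed.

(** Only the first occurrence is reversed: edge lists are multigraphs of unit capacities. *)
Fixpoint swap (e : edge) (L : seq edge) : seq edge :=
  if L is e' :: L' then
    if e == e' then (e.2, e.1) :: L' else e' :: swap e L'
  else [::].

Lemma swap_computes e L :
  computes Fswap (Node (enc_pair e) (enc_pairs L)) (enc_pairs (swap e L))
    ((20 * tree_size (enc_pair e) + 30) * (size L).+1).
Proof.
case: e => x y; elim: L => [|[x' y'] L IH] /=; first by run swap_body; lia.
have := eq_computes (Node x y) (Node x' y').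
have -> : (Node x y == Node x' y') = ((x, y) == (x', y')) by [].
cbn [enc_pair fst snd] in *.
case: ((x, y) == (x', y')) => H; run swap_body; lia.
Qed.

Lemma size_swap e L : size (swap e L) = size L.
Proof. by elim: L => //= e' L IH; case: ifP => //= _; rewrite IH. Qed.

Lemma mem_swap e e' L : e' != e -> e' \in L -> e' \in swap e L.
Proof.
move=> ne; elim: L => //= f L IH; rewrite inE.
case: (e =P f) => [<-|_]; rewrite !inE; first by rewrite (negPf ne) /= => ->; rewrite orbT.
by case/predU1P=> [->|/IH->]; rewrite ?eqxx ?orbT.
Qed.

Lemma swap_sub e L f : f \in swap e L -> f \in L \/ f = (e.2, e.1) /\ e \in L.
Proof.
elim: L => //= e' L IH; case: (e =P e') => [<-|_]; rewrite !inE.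
  by case/predU1P=> [->|->]; [right; rewrite eqxx|left; rewrite orbT].
by case/predU1P=> [->|/IH[->|[-> ->]]]; [left|left|right];
  rewrite ?eqxx ?orbT.
Qed.

(** Along a path these identities telescope, so that only the membership of the two end points in
    [R] matters. *)
Lemma cut_swap e L (R : pred tree) :
  e \in L -> cut (swap e L) R + R e.1 = cut L R + R e.2.
Proof.
elim: L => //= e' L IH; rewrite inE /cut /= in IH *.
case: (e =P e') => [<- _ /=|_ /= /IH{}IH]; last by lia.
by case: (R e.1) (R e.2) => [] []; lia.
Qed.

(** An edge leaving the union cannot start in the closed set [Q], so it starts in [R] and already
    leaves [R]. *)
Lemma cut_setU_closed (L : seq edge) (R Q : pred tree) :
  (forall e, e \in L -> Q e.1 -> Q e.2) -> cut L (predU R Q) <= cut L R.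
Proof.
rewrite /cut; elim: L => //= e L IH Qcl; rewrite leq_add ?IH //; last first.
  by move=> f fL; apply: Qcl; rewrite inE fL orbT.
have := Qcl e (mem_head _ _).
by case: (R e.1) (R e.2) (Q e.1) (Q e.2) => [] [] [] [] //= /(_ isT).
Qed.

Lemma enc_pairs_inj : injective (enc_pairs : seq edge -> tree).
Proof. by elim=> [|[x y] s IH] [|[x' y'] s'] //= [-> -> /IH ->]. Qed.

(** Every source is reached by the empty path, whose reversal leaves the network unchanged. *)
Definition init (A : seq edge) (L : seq edge) : seq edge :=
  [seq (e.1, enc_pairs L) | e <- A].

Lemma keys_init A L : keys (init A L) = keys A.
Proof. by rewrite /keys -map_comp. Qed.

Lemma init_computes A L :
  computes Finit (Node (enc_pairs A) (enc_pairs L)) (enc_pairs (init A L))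
    (30 * (size A).+1).
Proof. elim: A => [|[k w] A IH]; run init_body; lia. Qed.

(** * Searching for an augmenting path *)

Section Search.

Variables (U : seq tree) (Z m : nat).
Hypothesis U_size : forall x, x \in U -> tree_size x <= Z.

Definition inside (L : seq edge) : Prop :=
  forall e, e \in L -> e.1 \in U /\ e.2 \in U.

Definition net (L : seq edge) : Prop := inside L /\ size L = m.

Definition node_list (s : seq edge) : Prop :=
  uniq (keys s) /\ {subset keys s <= U}.

Definition disjoint_keys (s t : seq edge) : Prop :=
  forall x, x \in keys s -> x \notin keys t.

Let u := size U.

Lemma size_node_list s : node_list s -> size s <= u.
Proof. by case=> us sU; rewrite -(size_map fst); apply: uniq_leq_size. Qed.

Definition lookup_cost := (20 * Z + 30) * u.+1.
Definition swap_cost := (40 * Z + 50) * m.+1.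
Definition ext_cost n := (2 * lookup_cost + swap_cost + 60) * n.+1.

Lemma lookup_node x s : x \in U -> node_list s ->
  computes Flookup (Node x (enc_pairs s)) (lookup x s) lookup_cost.
Proof.
move=> /U_size xZ /size_node_list su; apply: evl_le (lookup_computes x s) _ _ => //.
by rewrite /lookup_cost leq_mul //; lia.
Qed.

Lemma swap_edge x y L : x \in U -> y \in U -> size L = m ->
  computes Fswap (Node (Node x y) (enc_pairs L)) (enc_pairs (swap (x, y) L)) swap_cost.
Proof.
move=> /U_size xZ /U_size yZ sL; apply: evl_le (swap_computes (x, y) L) _ _ => //.
by rewrite /swap_cost sL leq_mul //=; lia.
Qed.

Definition closed_in (L : seq edge) (s : seq edge) : Prop :=
  forall x y, (x, y) \in L -> x \in keys s -> y \in keys s.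

Lemma ext_spec vis E :
  node_list vis -> inside E ->
  (forall z w, (z, w) \in vis -> exists2 L, w = enc_pairs L & size L = m) ->
  exists2 res, computes Fext (Node (enc_pairs vis) (enc_pairs E)) res (ext_cost (size E))
    & res = Leaf /\ closed_in E vis \/
      exists x y L, [/\ (x, y) \in E, (x, enc_pairs L) \in vis,
        y \notin keys vis & res = Node y (enc_pairs (swap (x, y) L))].
Proof.
move=> nl; elim: E => [|[x y] E IH] inE visL.
  by exists Leaf; [run ext_body; rewrite /ext_cost; lia|left; split].
have [xU yU] := inE _ (mem_head _ _).
case: IH => [e eE|//|res Hres resP]; first by apply: inE; rewrite in_cons eE orbT.
rewrite /ext_cost in Hres *; set C := _ + 60 in Hres *.
have Hx := lookup_node xU nl; have Hy := lookup_node yU nl.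
have skip : (x \in keys vis -> y \in keys vis) ->
    res = Leaf /\ closed_in ((x, y) :: E) vis \/
    exists a b L, [/\ (a, b) \in (x, y) :: E, (a, enc_pairs L) \in vis,
      b \notin keys vis & res = Node b (enc_pairs (swap (a, b) L))].
  move=> xy; case: resP => [[-> cl]|[a [b [L [abE aL bv ->]]]]]; [left|right].
    by split=> // a b; rewrite in_cons => /predU1P[[-> ->]|/cl].
  by exists a, b, L; rewrite in_cons abE orbT.
move: Hx Hy; case: (lookupP x vis) => [w xw|xN].
  case: (lookupP y vis) => [w' yw'|yN] Hx Hy.
    exists res; first by run ext_body; rewrite [C * _.+2]mulnS /C; lia.
    by apply: skip => _; apply: mem_keys yw'.
  have [L wL sL] := visL _ _ xw; rewrite wL in Hx xw.
  have Hs := swap_edge xU yU sL.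
  exists (Node y (enc_pairs (swap (x, y) L))).
    by run ext_body; rewrite [C * _.+2]mulnS /C; lia.
  by right; exists x, y, L; rewrite mem_head.
move=> Hx _; exists res; first by run ext_body; rewrite [C * _.+2]mulnS /C; lia.
by apply: skip; rewrite (negPf xN).
Qed.

(** The effect on cuts of reversing a path from [A] to [y]: the cut of a set containing [A] drops by
    one if [y] lies outside it and is unchanged otherwise. The path itself is never recorded. *)
Definition reversed (A : seq tree) (L : seq edge) (y : tree) (L' : seq edge) :=
  net L' /\
  forall R : pred tree, {in A, forall a, R a} -> cut L' R + 1 = cut L R + R y.

(** The last clause says that edges with an unvisited head are intact in every stored network, so
    the next edge of a path can still be reversed there. *)
Definition visited (A : seq tree) (L vis : seq edge) : Prop :=
  forall z w, (z, w) \in vis -> exists L',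
    [/\ w = enc_pairs L', reversed A L z L'
      & forall x y, (x, y) \in L -> y \notin keys vis -> (x, y) \in L'].

Definition search_cost := ext_cost m + lookup_cost + 60.

Lemma net_swap x y L : net L -> (x, y) \in L -> net (swap (x, y) L).
Proof.
case=> iL sL xyL; split; last by rewrite size_swap.
move=> e /swap_sub[/iL //|[-> _]] /=; by have [] := iL _ xyL.
Qed.

(** Every recursive call visits a new node of [U], hence the induction on [u - size vis]. The search
    stops when the visited set is closed or when it meets a sink. *)
Lemma search_spec A B L vis :
  net L -> node_list B -> node_list vis -> disjoint_keys vis B ->
  {subset A <= keys vis} -> visited A L vis ->
  exists2 res,
    computes Fsearch (Node (enc_pairs vis) (Node (enc_pairs L) (enc_pairs B)))
      res (search_cost * (u - size vis).+1)
  & (exists2 Q, res = Node Leaf (enc_pairs Q) &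
      [/\ node_list Q, disjoint_keys Q B, {subset A <= keys Q} & closed_in L Q]) \/
    (exists L' y, [/\ res = Node (Node Leaf Leaf) (enc_pairs L'),
      y \in keys B & reversed A L y L']).
Proof.
move=> nL nB; have [iL sL] := nL.
have [n] := ubnP (u - size vis); elim: n vis => // n IH vis ltn nv dvB sAv Hv.
have [|res Hres] := ext_spec nv iL.
  by move=> z w /Hv[L' [-> [[_ sL'] _] _]]; exists L'.
rewrite sL in Hres; case=> [[res0 cl]|[x [y [L' [xyL xL' yv resE]]]]].
  subst res; exists (Node Leaf (enc_pairs vis)); last by left; exists vis.
  by run search_body; rewrite mulnS; move: (search_cost * _) => k; rewrite /search_cost; lia.
have [xU yU] := iL _ xyL.
have [L'' [/enc_pairs_inj EL [nL' cL'] mL']] := Hv _ _ xL'; subst L'' res.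
(* As [y] is unvisited, the edge is still present in the network stored at [x]. *)
have xyL' := mL' _ _ xyL yv.
have nL'' := net_swap nL' xyL'.
have rev_y : reversed A L y (swap (x, y) L').
  split=> // R AR; have := cut_swap R xyL'; have := cL' R AR => /=; lia.
have Hy := lookup_node yU nB; move: Hy.
case: lookupP => [w yB|yB] Hy.
  exists (Node (Node Leaf Leaf) (enc_pairs (swap (x, y) L'))).
    by run search_body; rewrite mulnS; move: (search_cost * _) => k; rewrite /search_cost; lia.
  by right; exists (swap (x, y) L'), y; split=> //; apply: mem_keys yB.
pose vis' := (y, enc_pairs (swap (x, y) L')) :: vis.
have nv' : node_list vis'.
  case: nv => uv sv; split; first by rewrite /= yv.
  by move=> z; rewrite inE => /predU1P[->|/sv].
have := size_node_list nv'; rewrite /= => sv'.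
have [|//||||res Hr Hres'] := IH vis'.
- by rewrite /=; lia.
- by move=> z; rewrite inE => /predU1P[->|/dvB].
- by move=> z /sAv zv; rewrite inE zv orbT.
- move=> z w; rewrite inE => /predU1P[[-> ->]|zw].
    (* The swap destroys only a copy of [(x, y)], and [y] is visited from now on. *)
    exists (swap (x, y) L'); split=> // a b abL; rewrite inE negb_or => /andP[by_ bv].
    apply: mem_swap; last exact: mL'.
    by apply: contra by_ => /eqP[_ ->].
  have [M [-> rM mM]] := Hv _ _ zw; exists M; split=> // a b abL.
  by rewrite inE negb_or => /andP[_ bv]; apply: mM.
exists res => //; run search_body.
have -> : u - size vis = (u - size vis').+1 by rewrite /=; lia.
by rewrite [search_cost * _.+2]mulnS; move: (search_cost * _) => k; rewrite /search_cost; lia.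
Qed.

Lemma visited_init A L : net L -> visited (keys A) L (init A L).
Proof.
move=> nL z w /mapP[e eA [-> ->]]; exists L; split=> //.
by split=> // R AR; rewrite AR //; apply: map_f.
Qed.

Definition pick_cost n := (3 * lookup_cost + 80) * n.+1.

Lemma pick_spec Q B E : node_list Q -> node_list B -> inside E ->
  exists2 res,
    computes Fpick (Node (enc_pairs Q) (Node (enc_pairs B) (enc_pairs E))) res
      (pick_cost (size E))
  & res = Leaf /\
      (forall x y, (x, y) \in E -> x \in keys Q -> y \notin keys B -> y \in keys Q) \/
    exists x y, [/\ res = Node x y, (x, y) \in E, x \in keys Q, y \notin keys Q
      & y \notin keys B].
Proof.
move=> nQ nB; elim: E => [|[x y] E IH] inE.
  by exists Leaf; [run pick_body; rewrite /pick_cost; lia|left].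
have [xU yU] := inE _ (mem_head _ _).
case: IH => [e eE|res Hres resP]; first by apply: inE; rewrite in_cons eE orbT.
rewrite /pick_cost in Hres *; set C := _ + 80 in Hres *.
have Hx := lookup_node xU nQ; have Hy := lookup_node yU nQ.
have Hz := lookup_node yU nB.
have skip : (x \in keys Q -> y \notin keys B -> y \in keys Q) ->
    res = Leaf /\ (forall a b, (a, b) \in (x, y) :: E -> a \in keys Q ->
      b \notin keys B -> b \in keys Q) \/
    exists a b, [/\ res = Node a b, (a, b) \in (x, y) :: E, a \in keys Q,
      b \notin keys Q & b \notin keys B].
  move=> xy; case: resP => [[-> cl]|[a [b [-> abE aQ bQ bB]]]]; [left|right].
    by split=> // a b; rewrite in_cons => /predU1P[[-> ->]|/cl]; auto.
  by exists a, b; rewrite in_cons abE orbT.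
move: Hx Hy Hz; case: (lookupP x Q) => [w xw|xN]; last first.
  move=> Hx _ _; exists res; first by run pick_body; rewrite [C * _.+2]mulnS /C; lia.
  by apply: skip; rewrite (negPf xN).
case: (lookupP y Q) => [w' yw|yN].
  move=> Hx Hy _; exists res; first by run pick_body; rewrite [C * _.+2]mulnS /C; lia.
  by apply: skip => _ _; apply: mem_keys yw.
case: (lookupP y B) => [w' yw|yNB] Hx Hy Hz.
  exists res; first by run pick_body; rewrite [C * _.+2]mulnS /C; lia.
  by apply: skip; rewrite (mem_keys yw).
exists (Node x y); first by run pick_body; rewrite [C * _.+2]mulnS /C; lia.
by right; exists x, y; split=> //; [exact: mem_head|exact: mem_keys xw].
Qed.

End Search.

(** * Enumerating the important cuts *)

Definition insert (v : tree) (acc : seq tree) : seq tree :=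
  if v \in acc then acc else rcons acc v.

Lemma insert_computes v acc :
  computes Finsert (Node v (enc_trees acc)) (enc_trees (insert v acc))
    ((20 * tree_size v + 30) * (size acc).+1).
Proof.
elim: acc => [|a acc IH]; first by run insert_body; lia.
rewrite /insert inE in IH *; have := eq_computes v a.
case: (v == a) => H; first by run insert_body; lia.
have -> : enc_trees (if v \in acc then a :: acc else rcons (a :: acc) v) =
  Node a (enc_trees (if v \in acc then acc else rcons acc v)) by case: ifP.
run insert_body; lia.
Qed.

(** The vertex of which the node [y] is a copy. *)
Definition label (y : tree) : tree := if y is Node v _ then v else Leaf.

Section Output.

Variables (U X : seq tree) (Z : nat).
Hypothesis U_size : forall x, x \in U -> tree_size x <= Z.
Hypothesis X_size : forall x, x \in X -> tree_size x <= Z.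
Hypothesis leXU : size X <= size U.

(** The test for [Leaf] in [out_body] discards the accumulator; excluding [Leaf] as a head rules
    this out. *)
Definition labelled (E : seq edge) : Prop :=
  forall e, e \in E -> e.2 <> Leaf /\ label e.2 \in X.

Let cost := lookup_cost U Z.

Definition out_cost n := (3 * cost + 80) * n.+1.

Lemma insert_label v acc : v \in X -> uniq acc -> {subset acc <= X} ->
  computes Finsert (Node v (enc_trees acc)) (enc_trees (insert v acc)) cost.
Proof.
move=> /X_size vZ ua aX; apply: evl_le (insert_computes v acc) _ _ => //.
have := leq_trans (uniq_leq_size ua aX) leXU => le_acc.
by rewrite /cost /lookup_cost leq_mul //; lia.
Qed.

(** Each edge leaving [Q] adds at most one label, which bounds the growth of the accumulator by the
    cut value. *)
Lemma out_spec Q E acc :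
  node_list U Q -> inside U E -> labelled E -> uniq acc -> {subset acc <= X} ->
  exists2 acc',
    computes Fout (Node (enc_pairs Q) (Node (enc_pairs E) (enc_trees acc)))
      (enc_trees acc') (out_cost (size E))
  & [/\ uniq acc', {subset acc' <= X}, {subset acc <= acc'},
      size acc' <= size acc + cut E (mem (keys Q))
      & forall x y, (x, y) \in E -> x \in keys Q -> y \notin keys Q ->
        label y \in acc'].
Proof.
move=> nQ; elim: E acc => [|[x y] E IH] acc insE labE ua aX.
  exists acc; first by run out_body; rewrite /out_cost; lia.
  by split=> //; rewrite leq_addr.
have [/= xU yU] := insE _ (mem_head _ _).
have [/= yN yX] := labE _ (mem_head _ _).
have insE' : inside U E by move=> e eE; apply: insE; rewrite in_cons eE orbT.
have labE' : labelled E by move=> e eE; apply: labE; rewrite in_cons eE orbT.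
have Hx := lookup_node U_size xU nQ; have Hy := lookup_node U_size yU nQ.
have Hskip := IH acc insE' labE' ua aX.
rewrite /out_cost -/cost in IH Hskip Hx Hy *; set C := _ + 80 in IH Hskip *.
have skip : ~~ ((x \in keys Q) && (y \notin keys Q)) -> 
  forall acc', [/\ uniq acc', {subset acc' <= X}, {subset acc <= acc'},
      size acc' <= size acc + cut E (mem (keys Q))
      & forall x y, (x, y) \in E -> x \in keys Q -> y \notin keys Q ->
        label y \in acc'] ->
  [/\ uniq acc', {subset acc' <= X}, {subset acc <= acc'},
      size acc' <= size acc + cut ((x, y) :: E) (mem (keys Q))
      & forall a b, (a, b) \in (x, y) :: E -> a \in keys Q -> b \notin keys Q ->
        label b \in acc'].
  move=> Nxy acc' [ua' aX' aa' sa la]; split=> //.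
    by move: sa; rewrite /cut /=; lia.
  move=> a b; rewrite in_cons => /predU1P[[-> ->] xQ yQ|]; last exact: la.
  by rewrite xQ yQ in Nxy.
move: Hx Hy; case: lookupP => [w xw|xNQ].
  case: lookupP => [w' yw|yNQ] Hx Hy.
    case: Hskip => acc' Hacc' /skip acc'P; exists acc'.
      by run out_body; rewrite [C * _.+2]mulnS /C; lia.
    by apply: acc'P; rewrite (mem_keys yw) andbF.
  have Hi := insert_label yX ua aX.
  case: (IH (insert (label y) acc)) => //.
  - by rewrite /insert; case: ifP => // lN; rewrite rcons_uniq lN.
  - by rewrite /insert; case: ifP => // lN z; rewrite mem_rcons inE => /predU1P[->|/aX].
  move=> acc' Hacc' [ua' aX' aa' sa la]; exists acc'.
    case: y yN {insE labE yU yX skip yNQ la} Hy Hi aa' sa Hacc' => //= v tag _ Hy Hi aa' sa Hacc'.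
    by run out_body; rewrite [C * _.+2]mulnS /C; lia.
  have li : label y \in insert (label y) acc.
    by rewrite /insert; case: ifP => // _; rewrite mem_rcons mem_head.
  split=> //.
  - move=> z za; apply: aa'; rewrite /insert; case: ifP => // _.
    by rewrite mem_rcons inE za orbT.
  - have xQ := mem_keys xw.
    move: sa; rewrite /cut /= xQ yNQ /=; set c := count _ _.
    by rewrite /insert; case: ifP => _; rewrite ?size_rcons; lia.
  - move=> a b; rewrite in_cons => /predU1P[[_ ->] _ _|]; last exact: la.
    exact: aa'.
move=> Hx _; case: Hskip => acc' Hacc' /skip acc'P; exists acc'.
  by run out_body; rewrite [C * _.+2]mulnS /C; lia.
by apply: acc'P; rewrite (negPf xNQ).
Qed.

End Output.

(** Two branches, each with one unit of budget less, are paid for by doubling; an exhausted budget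
    opens no branch. *)
Lemma branch_sizes p q r :
  (0 < q) * (p * 2 ^ (q + r).-1) + (0 < r) * (p * 2 ^ (q + r).-1)
    <= p * 2 ^ (q + r).
Proof.
case: (posnP (q + r)) => [/eqP|qr0].
  by rewrite addn_eq0 => /andP[/eqP-> /eqP->]; rewrite !mul0n.
set k := p * _; have -> : p * 2 ^ (q + r) = k + k.
  by rewrite -{1}(prednK qr0) expnS mul2n -addnn mulnDr.
by case: (0 < q) (0 < r) => [] []; lia.
Qed.

Section Enumerate.

Variables (U X : seq tree) (Z m p : nat) (L0 : seq edge) (B0 : seq tree).
Hypothesis U_size : forall x, x \in U -> tree_size x <= Z.
Hypothesis X_size : forall x, x \in X -> tree_size x <= Z.
Hypothesis leXU : size X <= size U.
Hypothesis net0 : net U m L0.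
Hypothesis lab0 : labelled X L0.

Let u := size U.

(** These edges lie in the cut of every set that contains [A] and avoids [B]. *)
Definition cross (A B : seq tree) : nat :=
  count (fun e => (e.1 \in A) && (e.2 \in B)) L0.

Lemma cross_cons A B x y :
  x \in A -> y \notin B -> (x, y) \in L0 -> cross A B < cross A (y :: B).
Proof.
move=> xA yB; rewrite /cross; elim: L0 => //= -[a b] L IH; rewrite !inE /=.
case/predU1P=> [[<- <-]|/IH{}IH].
  rewrite xA eqxx (negPf yB) /= add0n ltnS; apply: sub_count => e /= /andP[-> eB].
  by rewrite inE eB orbT.
by rewrite -addnS leq_add //; case: (a \in A); case: (b == y); case: (b \in B).
Qed.

(* Every node of [R] is reached from [A] by a path of [L0] inside [R]. *)
Definition reach (A : seq tree) (R : pred tree) : Prop :=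
  forall Q : pred tree, {in A, forall a, Q a} ->
    (forall x y, (x, y) \in L0 -> Q x -> R x -> R y -> Q y) ->
    forall z, R z -> Q z.

Definition admissible (A B : seq tree) (R : pred tree) : Prop :=
  [/\ {in A, forall a, R a}, {in B, forall b, ~~ R b}, reach A R & cut L0 R <= p].

(** [Q] is the listed set that contains [R]; of its cut only the labels of the heads are kept. *)
Definition covered (R : pred tree) (acc : seq tree) : Prop :=
  exists2 Q : pred tree, subpred R Q /\ {in B0, forall b, ~~ Q b}
    & forall x y, (x, y) \in L0 -> Q x -> ~~ Q y -> label y \in acc.

Lemma covered_sub R R' acc acc' :
  subpred R R' -> {subset acc <= acc'} -> covered R' acc -> covered R acc'.
Proof.
move=> RR' aa' [Q [R'Q B0Q] Qacc]; exists Q; first by split=> // x /RR' /R'Q.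
by move=> x y xy Qx Qy; apply/aa'/(Qacc x y).
Qed.

Definition base (fl : bool) (A : seq edge) : seq edge := if fl then behead A else A.

(* [L] is a residual network of [L0] in which [p - q] paths have been reversed,
   and [p - r] is the number of edges known to lie in every admissible cut.
   With [fl] set, the head of [A] is only tentatively a source. *)
Definition state (fl : bool) (A B L : seq edge) (q r : nat) : Prop :=
  [/\ [/\ node_list U A, node_list U B & disjoint_keys A B],
      {subset B0 <= keys B} /\ net U m L,
      forall R : pred tree, {in keys (base fl A), forall a, R a} ->
        {in keys B, forall b, ~~ R b} -> cut L R + p = cut L0 R + q,
      p <= r + cross (keys (base fl A)) (keys B)
    & fl -> exists x y w Q, [/\ A = (y, w) :: Q, x \in keys Q & (x, y) \in L0]].

Definition go_input fl A B L q r acc : tree :=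
  Node (enc_bool fl) (Node (enc_pairs A) (Node (enc_pairs B) (Node (enc_pairs L)
    (Node (enc_nat q) (Node (enc_nat r) (Node (enc_trees acc) (enc_pairs L0))))))).

Definition step_cost :=
  30 * u.+1 + search_cost U Z m * u.+1 + pick_cost U Z m + out_cost U Z m + 200.

(** Bounds the calls below a branching. Either branch may start from any list of sources, so at most
    [u.+1] calls pass before it branches again, with one unit of budget less. *)
Fixpoint branch_calls (c : nat) : nat :=
  if c is c'.+1 then 2 * (u.+1 + branch_calls c') else 0.

Definition calls (s c : nat) : nat := (u - s).+1 + branch_calls c.

Definition go_post fl A B q r acc acc' : Prop :=
  [/\ uniq acc', {subset acc' <= X}, {subset acc <= acc'},
      size acc' <= size acc + p * 2 ^ (q + r)
    & forall R, admissible (keys (base fl A)) (keys B) R -> covered R acc'].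

(** Induction on [calls], which serves both as termination measure and as time bound: it drops when
    a tentative source is added at equal budget, and when either budget is spent. *)
Lemma go_spec fl A B L q r acc :
  state fl A B L q r -> uniq acc -> {subset acc <= X} ->
  exists2 acc',
    computes Fgo (go_input fl A B L q r acc) (enc_trees acc')
      (step_cost * calls (size A) (q + r))
  & go_post fl A B q r acc acc'.
Proof.
have [n] := ubnP (calls (size A) (q + r)).
elim: n fl A B L q r acc => // n IH fl A B L q r acc lt_n.
move=> [[nA nB dAB] [B0B nL] hcut hr hfl] ua aX.
have [i0 s0] := net0.
have sA := size_node_list nA.
have subA : {subset keys (base fl A) <= keys A}.
  by rewrite /base; case: (fl) => // z; case: (A) => //= a A' zA; rewrite inE zA orbT.
have Hinit := init_computes A L.
have nI : node_list U (init A L) by rewrite /node_list keys_init.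
have [||res Hres resP] := search_spec U_size nL nB nI _ _ (visited_init nL).
- by move=> z; rewrite keys_init; apply: dAB.
- by move=> z; rewrite keys_init.
set C := search_cost U Z m in Hres.
have le_search : C * (size U - size (init A L)).+1 <= C * u.+1.
  by rewrite leq_mul2l ltnS leq_subr orbT.
have small : step_cost <= step_cost * calls (size A) (q + r).
  by rewrite leq_pmulr.
have D_step : step_cost = 30 * u.+1 + C * u.+1 + pick_cost U Z m + out_cost U Z m + 200 by [].
case: resP => [[Q resE [nQ dQB AQ clQ]]|[L' [y [resE yB [nL' cutL']]]]]; subst res.
  (* By [hcut], residual and original cuts differ by a constant on sets separating the sources from
     [B]. Adding the closed set [Q] does not raise the residual cut, so it does not raise the
     original one. *)
  have cutQ R : admissible (keys (base fl A)) (keys B) R ->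
    admissible (keys Q) (keys B) (predU R (mem (keys Q))).
    move=> [AR BR reachR cutR]; split.
    - by move=> a /= ->; rewrite orbT.
    - move=> b bB; rewrite /= negb_or BR //=; apply: contraL bB; exact: dQB.
    - move=> P QP Pcl z /= /orP[Rz|/QP //].
      apply: (reachR P) => //; first by move=> a /subA/AQ/QP.
      by move=> a b ab Pa Ra Rb; apply: (Pcl a b) => //=; rewrite ?Ra ?Rb.
    - have := @cut_setU_closed L R (mem (keys Q)) (fun e eL => clQ e.1 e.2 _).
      have H1 := hcut R AR BR.
      have H2 : cut L (predU R (mem (keys Q))) + p = cut L0 (predU R (mem (keys Q))) + q.
        apply: hcut => [a aA|b bB] /=; first by rewrite AR.
        by rewrite negb_or BR //=; apply: contraL bB; exact: dQB.
      have : cut L (predU R (mem (keys Q))) <= cut L R.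
        by apply: cut_setU_closed => -[a b] /= abL; apply: clQ abL.
      lia.
  have [res Hpick resP] := pick_spec U_size nQ nB i0.
  rewrite s0 in Hpick.
  case: resP => [[resE cl]|[x [y [resE xyL0 xQ yQ yB]]]]; subst res.
    have [acc' Hout [ua' aX' aa' sa la]] := out_spec U_size X_size leXU nQ i0 lab0 ua aX.
    rewrite s0 in Hout.
    exists acc'.
      by rewrite /go_input; run go_body; lia.
    split=> //.
      apply: leq_trans sa _; rewrite leq_add2l.
      (* No residual edge leaves [Q], so its original cut value is [p - q], at most [p]. *)
      have : cut L (mem (keys Q)) + p = cut L0 (mem (keys Q)) + q.
        by apply: hcut => [a /subA/AQ//|b bB]; apply: contraL bB; exact: dQB.
      have -> : cut L (mem (keys Q)) = 0.
        apply/eqP; rewrite -leqn0 leqNgt -has_count; apply/hasP=> -[[a b] abL /andP[/= aQ]].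
        by rewrite (clQ a b).
      have := leq_pmulr p (expn_gt0 2 (q + r)); lia.
    (* Every original edge out of [Q] ends in [Q] or in [B], and [R] avoids [B]; as [R] is reached
       from the sources inside itself, it never leaves [Q]. *)
    move=> R [AR BR reachR cutR]; exists (mem (keys Q)); last by move=> a b; apply: la.
    split; last by move=> b /B0B bB; apply: contraL bB; exact: dQB.
    apply: (reachR (mem (keys Q))); first by move=> a /subA/AQ.
    move=> a b ab /= aQ Ra Rb; apply: (cl a b) => //.
    by apply: contraL Rb; exact: BR.
  (* [y] is a tentative source: with the flag set, [base] strips it off again and leaves [Q]. *)
  pose A' := (y, Leaf) :: Q.
  have [_ yU] := i0 _ xyL0; rewrite /= in yU.
  have nA' : node_list U A'.
    case: nQ => uQ sQ; split; first by rewrite /= yQ.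
    by move=> z; rewrite inE => /predU1P[->|/sQ].
  have sA' := size_node_list nA'.
  have sAQ : size A <= size Q.
    rewrite -(size_map fst A) -(size_map fst Q); apply: uniq_leq_size => //.
    by case: nA.
  have lt_calls : calls (size A') (q + r) < calls (size A) (q + r).
    by rewrite /calls /=; rewrite /= in sA'; rewrite -/u in sA' *; lia.
  have st' : state true A' B L q r.
    split=> //.
    - split=> // z; rewrite inE => /predU1P[->//|]; exact: dQB.
    - move=> R QR BR; apply: hcut => // a /subA/AQ; exact: QR.
    - apply: leq_trans hr _; rewrite leq_add2l; apply: sub_count => -[a b] /= /andP[aA ->].
      by rewrite andbT; apply/AQ/subA.
    - by exists x, y, Leaf, Q.
  have [|acc' Hgo [ua' aX' aa' sa cov]] := IH _ _ _ _ _ _ _ _ st' ua aX; first by lia.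
  rewrite /go_input in Hgo; cbn [enc_bool enc_seq enc_pair fst snd A'] in Hgo.
  exists acc'.
    rewrite /go_input; run go_body.
    have : step_cost * (calls (size A') (q + r)).+1 <= step_cost * calls (size A) (q + r).
      by rewrite leq_mul2l lt_calls orbT.
    rewrite mulnS; move: (step_cost * calls (size A) _) => k1.
    cbn [size A']; move: (step_cost * _) => k2; lia.
  split=> // R /cutQ admR.
  apply: (covered_sub _ _ (cov _ admR)) => // z; by rewrite /= => ->.
(* The reversed path may start at the tentative source, so the drop is guaranteed only for sets
   containing all of [A]. *)
have cL' (R : pred tree) : {in keys A, forall a, R a} -> {in keys B, forall b, ~~ R b} ->
    cut L' R + 1 = cut L R.
  by move=> AR BR; rewrite cutL' // (negPf (BR _ yB)) addn0.
(* A time bound for one branch that does not depend on its list of sources. *)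
pose K := step_cost * (u.+1 + branch_calls (q + r).-1).
have K_total : 0 < q + r ->
    step_cost + 2 * K <= step_cost * calls (size A) (q + r).
  rewrite /K /calls; case: (q + r) => //= c _; rewrite mulnCA -mulnS.
  by rewrite leq_mul2l; apply/orP; right; lia.
have lt_calls s : 0 < q + r -> calls s (q + r).-1 < n.
  rewrite ltnS in lt_n; move=> gt0; apply: leq_trans lt_n.
  by rewrite /calls; case: (q + r) gt0 => //= c _; lia.
have le_K s : step_cost * calls s (q + r).-1 <= K.
  by rewrite leq_mul2l /calls leq_add2r ltnS leq_subr orbT.
(* First branch: all of [A] lies in [R]. For [q = 0] there is no such [R], because its original cut
   would be [cut L' R + 1 + p], above [p]. *)
have [acc1 Hacc1 [ua1 aX1 aa1 sa1 cov1]] : exists2 acc1,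
    (if q is q'.+1 then
       computes Fgo (go_input false A B L' q' r acc) (enc_trees acc1) K
     else acc1 = acc)
  & [/\ uniq acc1, {subset acc1 <= X}, {subset acc <= acc1},
        size acc1 <= size acc + (0 < q) * (p * 2 ^ (q + r).-1)
      & forall R : pred tree, {in keys A, forall a, R a} ->
        admissible (keys (base fl A)) (keys B) R -> covered R acc1].
  case Eq: q => [|q'].
    exists acc => //; split=> //; first by rewrite leq_addr.
    move=> R AR [bR BR _ cutR].
    by have := hcut R bR BR; have := cL' R AR BR; lia.
  have st' : state false A B L' q' r.
    split=> //.
      move=> R AR BR; have := cL' R AR BR.
      have := hcut R (fun a aA => AR a (subA a aA)) BR; lia.
    apply: leq_trans hr _; rewrite leq_add2l; apply: sub_count => -[a b] /= /andP[aA ->].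
    by rewrite andbT; apply: subA.
  have cE : (q + r).-1 = q' + r by rewrite Eq.
  have [|acc1 Hgo [ua1 aX1 aa1 sa1 cov]] := IH _ _ _ _ _ _ _ _ st' ua aX.
    by rewrite -cE; apply: lt_calls; rewrite Eq.
  exists acc1; first by apply: evl_le Hgo _ _ => //; rewrite -cE; apply: le_K.
  split=> //; first by rewrite mul1n -Eq cE.
  move=> R AR [bR BR reachR cutR]; apply: cov; split=> //.
  by move=> P AP; apply: reachR => a /subA/AP.
(* Second branch, only with the flag set: the tentative source [z] lies outside [R] and becomes a
   sink, so the edge [(x, z)] is counted by [cross]. For [r = 0] this already makes more than [p]
   cut edges. *)
have [acc2 Hacc2 [ua2 aX2 aa2 sa2 cov2]] : exists2 acc2,
    (if fl then
       if r is r'.+1 then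
         exists e Q, A = e :: Q /\
           computes Fgo (go_input false Q (e :: B) L q r' acc1) (enc_trees acc2) K
       else acc2 = acc1
     else acc2 = acc1)
  & [/\ uniq acc2, {subset acc2 <= X}, {subset acc1 <= acc2},
        size acc2 <= size acc1 + (0 < r) * (p * 2 ^ (q + r).-1)
      & forall R, admissible (keys (base fl A)) (keys B) R -> covered R acc2].
  case Efl: fl; last first.
    exists acc1 => //; split=> //; first by rewrite leq_addr.
    by rewrite Efl in cov1; move=> R admR; apply: cov1 => //; case: admR.
  have [x [z [w [Q [AE xQ xzL0]]]]] := hfl Efl.
  rewrite Efl AE /= in hcut hr cov1 *.
  have zB : z \notin keys B by apply: dAB; rewrite AE mem_head.
  have zQ : z \notin keys Q by case: nA; rewrite AE /= => /andP[].
  have cross_z : cross (keys Q) (keys B) < cross (keys Q) (keys ((z, w) :: B)).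
    exact: cross_cons xQ zB xzL0.
  case Er: r => [|r'].
    exists acc1 => //; split=> //; first by rewrite leq_addr.
    move=> R admR; apply: cov1 => // a; rewrite inE => /predU1P[->|]; last first.
      by case: admR => QR _ _ _; apply: QR.
    case: admR => QR BR _ cutR; apply/negPn/negP=> Rz.
    suff : cross (keys Q) (keys ((z, w) :: B)) <= cut L0 R by lia.
    apply: sub_count => -[a' b'] /= /andP[a'Q]; rewrite inE QR //=.
    by case/predU1P=> [->|/BR].
  have st' : state false Q ((z, w) :: B) L q r'.
    split=> //.
    - split.
      + case: nA; rewrite AE => /= /andP[_ uQ] sQ; split=> // a aQ.
        by apply: sQ; rewrite inE aQ orbT.
      + case: nB nA => uB sB [_ sA']; split; first by rewrite /= zB.
        move=> b; rewrite inE => /predU1P[->|/sB//]; apply: sA'.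
        by rewrite AE mem_head.
      + move=> a aQ; rewrite inE negb_or dAB ?AE ?inE ?aQ ?orbT // andbT.
        by apply: contraNneq zQ => /= <-.
    - by split=> // b /B0B bB; rewrite inE bB orbT.
    - move=> R QR BR; apply: hcut => // b bB; apply: BR.
      by rewrite inE bB orbT.
    - by rewrite /base; lia.
  have cE : (q + r).-1 = q + r' by rewrite Er addnS.
  have [|acc2 Hgo [ua2 aX2 aa2 sa2 cov]] := IH _ _ _ _ _ _ _ _ st' ua1 aX1.
    by rewrite -cE; apply: lt_calls; rewrite Er addnS.
  exists acc2.
    exists (z, w), Q; split=> //; apply: evl_le Hgo _ _ => //.
    by rewrite -cE.
  split=> //; first by rewrite mul1n -Er cE.
  move=> R admR; have [QR BR reachR cutR] := admR.
  case Rz : (R z).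
    apply: covered_sub aa2 (cov1 R _ admR) => //.
    by move=> a; rewrite inE => /predU1P[->|/QR].
  apply: cov; split=> //.
  by move=> b; rewrite inE => /predU1P[->|/BR//]; rewrite Rz.
exists acc2; last first.
  split=> //; first by move=> a /aa1/aa2.
  apply: leq_trans sa2 (leq_trans (leq_add sa1 (leqnn _)) _).
  by rewrite -addnA leq_add2l branch_sizes.
(* Only the execution of [go_body] remains; the shapes of [q], [r] and the flag decide which
   recursive calls take place. *)
clear lt_calls le_K cov1 cov2 IH lt_n hcut hr hfl subA cL' cutL'.
have [qr0|qr_gt0] := posnP (q + r).
  have [q0 r0] : q = 0 /\ r = 0 by lia.
  subst q r; have -> : acc2 = acc by case: fl Hacc2 => Hacc2; congruence.
  rewrite /go_input; change (enc_nat 0) with Leaf.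
  by case: (fl); run go_body; lia.
have {}K_total := K_total qr_gt0.
rewrite /go_input in Hacc1 Hacc2 *.
move: K_total D_step le_search; rewrite -/u in sA *.
move: K (step_cost * calls _ _) (C * u.+1) => K0 T Cu in Hacc1 Hacc2 *.
move=> K_total D_step le_search.
case: q Hacc1 Hacc2 {qr_gt0 sa1 sa2 small} => [|q] Hacc1 Hacc2.
  subst acc1; change (enc_nat 0) with Leaf in *.
  case: fl Hacc2 => [|->]; last by run go_body; lia.
  case: r => [->|r [[z w] [Q [AE Hgo]]]].
    by change (enc_nat 0) with Leaf in *; run go_body; lia.
  subst A; change (enc_nat r.+1) with (Node Leaf (enc_nat r)).
  cbn [enc_bool enc_seq enc_pair fst snd] in *.
  run go_body; cbn [size] in sA; lia.
change (enc_nat q.+1) with (Node Leaf (enc_nat q)) in *.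
case: fl Hacc2 => [|->]; last by run go_body; lia.
case: r Hacc1 => [Hacc1 ->|r Hacc1 [[z w] [Q [AE Hgo]]]].
  by change (enc_nat 0) with Leaf in *; run go_body; lia.
change (enc_nat r.+1) with (Node Leaf (enc_nat r)) in *.
subst A; cbn [enc_bool enc_seq enc_pair fst snd] in *.
run go_body; cbn [size] in sA; lia.
Qed.
End Enumerate.

(** * The network of a digraph *)

(* The four copies of a vertex [x]: 0 is [x] seen from its out-edges, 1 from its
   in-edges, and an edge of [S] into [x] also leads to copy 2, whose only
   out-edge goes to the sink 3.  Cutting [1 -> 0] deletes [x], cutting [2 -> 3]
   pays for [x] being the head of an edge of [S]. *)
Definition copy (i : nat) (x : tree) : tree := Node x (enc_nat i).

Definition arcs (i : nat) (E : seq edge) : seq edge :=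
  [seq (copy 0 e.1, copy i e.2) | e <- E].

Fixpoint codes (n : nat) : seq tree :=
  if n is n'.+1 then enc_nat n' :: codes n' else [::].

Definition vertex_arcs (s : seq tree) : seq edge :=
  flatten [seq [:: (copy 1 x, copy 0 x); (copy 2 x, copy 3 x)] | x <- s].

Definition marked (i : nat) (s : seq tree) : seq edge := [seq (copy i x, Leaf) | x <- s].

Lemma arcs_computes i E L :
  computes Fmk (Node (enc_nat i) (Node (enc_pairs E) (enc_pairs L)))
    (enc_pairs (arcs i E ++ L)) (40 * (size E).+1).
Proof. elim: E => [|[x y] E IH]; run mk_body; lia. Qed.

Lemma vertex_arcs_computes n :
  computes FmkV (enc_nat n) (enc_pairs (vertex_arcs (codes n))) (60 * n.+1).
Proof.
elim: n => [|n IH]; first by change (enc_nat 0) with Leaf; run mkV_body.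
change (enc_nat n.+1) with (Node Leaf (enc_nat n)); run mkV_body; lia.
Qed.

Lemma sinks_computes n :
  computes FmkB (enc_nat n) (enc_pairs (marked 3 (codes n))) (40 * n.+1).
Proof.
elim: n => [|n IH]; first by change (enc_nat 0) with Leaf; run mkB_body.
change (enc_nat n.+1) with (Node Leaf (enc_nat n)); run mkB_body; lia.
Qed.

Lemma sources_computes s :
  computes FmkA (enc_trees s) (enc_pairs (marked 0 s)) (40 * (size s).+1).
Proof. elim: s => [|x s IH]; run mkA_body; lia. Qed.

Lemma double_computes k : computes Fdbl (enc_nat k) (enc_nat (2 * k)) (20 * k.+1).
Proof.
elim: k => [|k IH]; first by rewrite muln0; change (enc_nat 0) with Leaf; run dbl_body.
have -> : enc_nat (2 * k.+1) = Node Leaf (Node Leaf (enc_nat (2 * k))) by rewrite mulnS.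
change (enc_nat k.+1) with (Node Leaf (enc_nat k)); run dbl_body; lia.
Qed.

Definition network (n : nat) (E S : seq edge) : seq edge :=
  arcs 1 E ++ arcs 2 S ++ vertex_arcs (codes n).

Lemma main_computes n E S k T0 y T :
  let L := network n E S in
  computes Fgo (go_input L false (marked 0 T0) (marked 3 (codes n)) L
                  (2 * k) (2 * k) [::]) y T ->
  computes 0 (Node (enc_nat n) (Node (enc_pairs E) (Node (enc_pairs S)
               (Node (enc_nat k) (enc_trees T0))))) y
    (40 * (size E).+1 + 40 * (size S).+1 + 100 * n.+1 + 40 * (size T0).+1
     + 20 * k.+1 + 200 + T).
Proof.
move=> L Hgo; have HA := sources_computes T0; have HB := sinks_computes n.
have HV := vertex_arcs_computes n; have Hd := double_computes k.
have HS := arcs_computes 2 S (vertex_arcs (codes n)).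
have HE := arcs_computes 1 E (arcs 2 S ++ vertex_arcs (codes n)).
rewrite -/(network n E S) -/L in HE.
change (enc_nat 1) with (Node Leaf Leaf) in HE.
change (enc_nat 2) with (Node Leaf (Node Leaf Leaf)) in HS.
rewrite /go_input in Hgo; cbn [enc_bool enc_seq] in Hgo.
run main_body; lia.
Qed.

(** * Codes of vertices, and the nodes and arcs of the network *)

Lemma enc_nat_inj : injective enc_nat.
Proof. by elim=> [|m IH] [|n] // [eq_mn]; rewrite (IH n eq_mn). Qed.

Lemma tree_size_enc_nat n : tree_size (enc_nat n) = (2 * n).+1.
Proof. by elim: n => //= n ->; lia. Qed.

Lemma copy_inj i : injective (copy i).
Proof. by move=> x y []. Qed.

Lemma mem_codes n x : reflect (exists2 i, i < n & x = enc_nat i) (x \in codes n).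
Proof.
elim: n => [|n IH] /=; first by constructor; case.
rewrite inE; apply: (iffP predU1P) => [[->|/IH[i lt_in ->]]|[i lt_in xE]].
- by exists n.
- by exists i => //; apply: ltnW.
- move: lt_in; rewrite ltnS leq_eqVlt => /predU1P[eq_in|lt_in]; first by left; rewrite xE eq_in.
  by right; apply/IH; exists i.
Qed.

Lemma uniq_codes n : uniq (codes n).
Proof.
elim: n => //= n ->; rewrite andbT; apply/mem_codes => -[i lt_in /enc_nat_inj eq_ni].
by rewrite eq_ni ltnn in lt_in.
Qed.

Lemma size_codes n : size (codes n) = n.
Proof. by elim: n => //= n ->. Qed.

Lemma size_vertex_arcs s : size (vertex_arcs s) = 2 * size s.
Proof. by elim: s => //= x s; rewrite /vertex_arcs /= => ->; lia. Qed.

Lemma cut_cat L1 L2 R : cut (L1 ++ L2) R = cut L1 R + cut L2 R.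
Proof. exact: count_cat. Qed.

Lemma cut_vertex_arcs s (R : pred tree) :
  cut (vertex_arcs s) R = count (fun x => R (copy 1 x) && ~~ R (copy 0 x)) s
    + count (fun x => R (copy 2 x) && ~~ R (copy 3 x)) s.
Proof. by elim: s => //= x s; rewrite /vertex_arcs /cut /= => ->; lia. Qed.

Lemma enc_seq_map (A B : Type) (f : A -> B) (enc : B -> tree) s :
  enc_seq enc (map f s) = enc_seq (enc \o f) s.
Proof. by elim: s => //= x s ->. Qed.

Section Digraph.

Variables (V : finType) (E S : {set V * V}) (T0 : {set V}).

Local Notation code := (@enc_vertex V).

Definition enc_arc (e : V * V) : edge := (code e.1, code e.2).

Lemma code_inj : injective code.
Proof. by move=> x y /enc_nat_inj/val_inj/enum_rank_inj. Qed.

Lemma code_codes x : code x \in codes #|V|.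
Proof. by apply/mem_codes; exists (enum_rank x). Qed.

Lemma codes_code a : a \in codes #|V| -> exists x, a = code x.
Proof.
case/mem_codes=> i lt_i ->; exists (enum_val (Ordinal lt_i)).
by rewrite /enc_vertex enum_valK.
Qed.

Lemma perm_codes : perm_eq (codes #|V|) [seq code x | x <- enum V].
Proof.
apply: uniq_perm; [exact: uniq_codes|by rewrite map_inj_uniq ?enum_uniq //; apply: code_inj|].
move=> a; apply/idP/mapP => [/codes_code[x ->]|[x _ ->]]; last exact: code_codes.
by exists x => //; rewrite mem_enum.
Qed.

Definition nodes : seq tree := [seq copy i a | i <- iota 0 4, a <- codes #|V|].

Lemma mem_nodes i x : i < 4 -> copy i (code x) \in nodes.
Proof. by move=> i4; apply: allpairs_f; rewrite ?mem_iota ?code_codes. Qed.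

Lemma size_nodes : size nodes = 4 * #|V|.
Proof. by rewrite size_allpairs size_iota size_codes. Qed.

Lemma tree_size_nodes a : a \in nodes -> tree_size a <= 2 * #|V| + 9.
Proof.
case/allpairsP=> -[i x] [i4 /mem_codes[j lt_j xE] ->].
rewrite mem_iota in i4; rewrite /= in i4 xE *.
rewrite xE !tree_size_enc_nat.
have bound (i' j' n : nat) : i' < 4 -> j' < n -> (2 * j').+1 + (2 * i').+1 < 2 * n + 9.
  by lia.
exact: bound.
Qed.

Definition digraph_network : seq edge :=
  network #|V| [seq enc_arc e | e <- enum E] [seq enc_arc e | e <- enum S].

Local Notation L0 := digraph_network.

Variant arc_spec : edge -> Prop :=
| ArcE e of e \in E : arc_spec (copy 0 (code e.1), copy 1 (code e.2))
| ArcS e of e \in S : arc_spec (copy 0 (code e.1), copy 2 (code e.2))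
| ArcV x : arc_spec (copy 1 (code x), copy 0 (code x))
| ArcT x : arc_spec (copy 2 (code x), copy 3 (code x)).

Lemma mem_network e : e \in L0 <-> arc_spec e.
Proof.
rewrite /L0 /network !mem_cat; split.
  case/or3P=> [/mapP[_ /mapP[f fE ->] ->]|/mapP[_ /mapP[f fS ->] ->]|/flattenP[s]].
  - by rewrite mem_enum in fE; constructor.
  - by rewrite mem_enum in fS; constructor.
  - by case/mapP=> a /codes_code[x ->] ->; rewrite !inE => /orP[] /eqP ->; constructor.
case=> [f fE|f fS|x|x]; apply/or3P; [apply: Or31|apply: Or32|apply: Or33|apply: Or33].
- by apply/mapP; exists (enc_arc f) => //; rewrite map_f ?mem_enum.
- by apply/mapP; exists (enc_arc f) => //; rewrite map_f ?mem_enum.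
- apply/flattenP.
  exists [:: (copy 1 (code x), copy 0 (code x)); (copy 2 (code x), copy 3 (code x))].
    by apply/mapP; exists (code x) => //; apply: code_codes.
  by rewrite mem_head.
- apply/flattenP.
  exists [:: (copy 1 (code x), copy 0 (code x)); (copy 2 (code x), copy 3 (code x))].
    by apply/mapP; exists (code x) => //; apply: code_codes.
  by rewrite !inE eqxx orbT.
Qed.

Lemma net_network : net nodes (#|E| + #|S| + 2 * #|V|) L0.
Proof.
split; last first.
  by rewrite !size_cat !size_map size_vertex_arcs size_codes -!cardE addnA.
by move=> e /mem_network[f _|f _|x|x]; split; apply: mem_nodes.
Qed.

Lemma labelled_network : labelled (codes #|V|) L0.
Proof. by move=> e /mem_network[f _|f _|x|x]; split=> //; apply: code_codes. Qed.

Definition sources : seq edge := marked 0 [seq code x | x <- enum T0].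
Definition sinks : seq edge := marked 3 (codes #|V|).

Lemma keys_marked i s : keys (marked i s) = map (copy i) s.
Proof. by rewrite /keys -map_comp. Qed.

Lemma node_list_sources : node_list nodes sources.
Proof.
split; rewrite keys_marked.
  by rewrite map_inj_uniq ?map_inj_uniq ?enum_uniq //; [apply: code_inj|apply: copy_inj].
by move=> _ /mapP[_ /mapP[x _ ->] ->]; apply: mem_nodes.
Qed.

Lemma node_list_sinks : node_list nodes sinks.
Proof.
split; rewrite keys_marked.
  by rewrite map_inj_uniq ?uniq_codes //; apply: copy_inj.
by move=> _ /mapP[_ /codes_code[x ->] ->]; apply: mem_nodes.
Qed.

(** At the start nothing is reversed and no edge is known to be cut, so both budgets are full. *)
Lemma state_init p : state nodes (#|E| + #|S| + 2 * #|V|) p L0 (keys sinks)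
  false sources sinks L0 p p.
Proof.
split=> //; last by rewrite leq_addr.
  split; [exact: node_list_sources|exact: node_list_sinks|].
  move=> a; rewrite !keys_marked => /mapP[x _ ->].
  by apply/mapP=> -[y _ []].
split=> //; exact: net_network.
Qed.

(** [P] gives one vertex set per copy. Missing entries are empty, so a list of three sets contains
    no sink. *)
Definition region (P : seq {set V}) (a : tree) : bool :=
  [exists x, has (fun i => (a == copy i (code x)) && (x \in nth set0 P i)) (iota 0 4)].

Lemma regionE P i x : i < 4 -> region P (copy i (code x)) = (x \in nth set0 P i).
Proof.
move=> i4; apply/existsP/idP => [[y /hasP[j _ /andP[/eqP[/code_inj-> /enc_nat_inj->]]]]//|xP].
by exists x; apply/hasP; exists i; rewrite ?mem_iota // eqxx.
Qed.

Lemma regionP P a : region P a ->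
  exists i x, [/\ i < 4, a = copy i (code x) & x \in nth set0 P i].
Proof.
by case/existsP=> x /hasP[i]; rewrite mem_iota => i4 /andP[/eqP -> xP]; exists i, x.
Qed.

(** * The region of the network determined by a witness of criticality *)

Section Critical.

Variable W : {set V}.

Definition reached : {set V} :=
  [set x | [exists t in T0 :\: W, connect (del_rel E W) t x]].

Lemma reachedP x : reflect (reachable E T0 W x) (x \in reached).
Proof. by rewrite inE; apply: (iffP exists_inP) => -[t tT ct]; exists t. Qed.

Definition successors (F : {set V * V}) : {set V} := [set e.2 | e in F & e.1 \in reached].

Lemma mem_successors (F : {set V * V}) e :
  e \in F -> e.1 \in reached -> e.2 \in successors F.
Proof. by move=> eF er; apply: imset_f; rewrite inE eF. Qed.

(** Copies 1 and 2 include deleted vertices entered from the reached set, so that no arc coming from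
    [E] or [S] leaves the region. *)
Definition reached_region : pred tree :=
  region [:: reached; successors E; successors S].

Hypothesis WT0 : W \subset ~: T0.
Hypothesis noS : forall e, e \in S -> ~ traversable E T0 W e.

Lemma reached_notin x : x \in reached -> x \notin W.
Proof.
case/reachedP=> t; rewrite inE => /andP[tW _] /connectP[s]; elim/last_ind: s => [|s y _] /=.
  by move=> _ ->.
by rewrite rcons_path last_rcons => /andP[_ /and3P[_ yW _]] ->.
Qed.

Lemma reached_T0 t : t \in T0 -> t \in reached.
Proof.
move=> tT; apply/reachedP; exists t; rewrite ?connect0 // inE tT andbT.
by apply: contraL tT => /(subsetP WT0); rewrite inE.
Qed.

Lemma successors_W x : x \in successors E -> x \notin reached -> x \in W.
Proof.
case/imsetP=> -[y z]; rewrite inE => /andP[/= yzE yr] -> zN; apply/negPn/negP=> zW.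
case/negP: zN; apply/reachedP; have /reachedP[t tT ct] := yr; exists t => //.
apply: connect_trans ct _; apply: connect1.
by apply/and3P; split; [exact: reached_notin|exact: zW|exact: yzE].
Qed.

Lemma successors_SW x : x \in successors S -> x \in W.
Proof.
case/imsetP=> e; rewrite inE => /andP[eS er] ->; apply/negPn/negP=> eW.
by case: (noS eS); split=> //; [exact: reached_notin|exact/reachedP].
Qed.

(** Only arcs from copy 1 to copy 0 and from copy 2 to copy 3 leave the region, and in both cases
    the vertex lies in [W]: otherwise it would be reached, or an edge of [S] would be traversable.
    Each vertex of [W] is thus paid for at most twice. *)
Lemma cut_reached_region : cut L0 reached_region <= 2 * #|W|.
Proof.
rewrite /L0 /network !cut_cat cut_vertex_arcs.
have cutE i F : i = 1 /\ F = E \/ i = 2 /\ F = S ->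
    cut (arcs i [seq enc_arc e | e <- enum F]) reached_region = 0.
  move=> iF; apply/eqP; rewrite -leqn0 leqNgt -has_count; apply/hasP.
  move=> -[_ /mapP[_ /mapP[e eF ->] ->] /=]; rewrite mem_enum in eF.
  rewrite /reached_region regionE //= => /andP[er].
  by case: iF => -[-> FE]; rewrite regionE //= mem_successors -?FE.
rewrite !cutE; [|by right|by left].
have leW (P : pred V) : subpred P (mem W) ->
    count [pred a | [exists x, (a == code x) && P x]] (codes #|V|) <= #|W|.
  move=> PW; rewrite (permP perm_codes) count_map -size_filter cardE.
  apply: uniq_leq_size; first by rewrite filter_uniq ?enum_uniq.
  move=> x; rewrite mem_filter mem_enum /= => /andP[/existsP[y /andP[/eqP/code_inj->]]].
  by move/PW.
rewrite !add0n mul2n -addnn; apply: leq_add.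
- apply: leq_trans (leW (fun x => (x \in successors E) && (x \notin reached)) _).
    rewrite leq_eqVlt; apply/orP; left; apply/eqP/eq_in_count => a /codes_code[x ->].
    rewrite /reached_region !regionE //=; apply/idP/existsP => [H|[y /andP[/eqP/code_inj->]]//].
    by exists x; rewrite eqxx.
  by move=> x /andP[]; apply: successors_W.
- apply: leq_trans (leW (fun x => (x \in successors S)) _).
    rewrite leq_eqVlt; apply/orP; left; apply/eqP/eq_in_count => a /codes_code[x ->].
    rewrite /reached_region !regionE //= in_set0 andbT.
    apply/idP/existsP => [H|[y /andP[/eqP/code_inj->]]//].
    by exists x; rewrite eqxx.
  by move=> x; apply: successors_SW.
Qed.

(** A path avoiding [W] lifts to the network by alternating copies 0 and 1 inside the region; the
    other nodes of the region are one arc away from copy 0 of a reached vertex. *)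
Lemma reach_reached_region : reach L0 (keys sources) reached_region.
Proof.
move=> Q AQ Qcl.
have Q0 x : x \in reached -> Q (copy 0 (code x)).
  move=> xr; have /reachedP[t] := xr; rewrite inE => /andP[_ tT] /connectP[s pth xE].
  have Qt : Q (copy 0 (code t)).
    by apply: AQ; rewrite keys_marked !map_f ?mem_enum.
  have {}tT := reached_T0 tT.
  elim: s t pth tT Qt xE => [|y s IH] t /=; first by move=> _ _ Qt ->.
  case/andP=> ty pth tr Qt; apply: IH => //.
    have /reachedP[t' t'T ct] := tr; apply/reachedP; exists t' => //.
    exact: connect_trans ct (connect1 ty).
  have /and3P[_ yW tyE] := ty.
  have yr : y \in reached.
    have /reachedP[t' t'T ct] := tr; apply/reachedP; exists t' => //.
    exact: connect_trans ct (connect1 ty).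
  have ys : y \in successors E by apply: (mem_successors tyE).
  apply: (Qcl (copy 1 (code y))); rewrite ?/reached_region ?regionE //.
    by apply/mem_network; constructor.
  apply: (Qcl (copy 0 (code t))); rewrite ?/reached_region ?regionE //.
  by apply/mem_network; apply: (ArcE tyE).
move=> z /regionP[[|[|[|i]]] [x [_ -> /= xP]]].
- exact: Q0.
- move: xP (xP) => /imsetP[e]; rewrite inE => /andP[eE er] -> es.
  apply: (Qcl (copy 0 (code e.1))); rewrite ?/reached_region ?regionE //; last exact: Q0.
  by apply/mem_network; constructor.
- move: xP (xP) => /imsetP[e]; rewrite inE => /andP[eE er] -> es.
  apply: (Qcl (copy 0 (code e.1))); rewrite ?/reached_region ?regionE //; last exact: Q0.
  by apply/mem_network; constructor.
- by move: xP; rewrite nth_nil inE.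
Qed.

Lemma admissible_reached_region k : #|W| <= k ->
  admissible (2 * k) L0 (keys sources) (keys sinks) reached_region.
Proof.
move=> Wk; split; [| |exact: reach_reached_region|].
- move=> a; rewrite keys_marked => /mapP[_ /mapP[x xT ->] ->].
  by rewrite /reached_region regionE //= reached_T0 // -mem_enum.
- move=> a; rewrite keys_marked => /mapP[_ /codes_code[x ->] ->].
  by rewrite /reached_region regionE //= inE.
- by apply: leq_trans cut_reached_region _; rewrite leq_mul2l Wk orbT.
Qed.

End Critical.

(** The covering set [Q] contains copy 0 of [u] and avoids copy 3 of [v], so it is left by one of
    the two arcs from copy 0 of [u] through copy 2 of [v] to copy 3 of [v]. Both arcs have a head
    labelled [v]. *)
Lemma critical_covered k v acc :
  (forall R, admissible (2 * k) L0 (keys sources) (keys sinks) R ->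
    covered L0 (keys sinks) R acc) ->
  critical E S T0 k v -> code v \in acc.
Proof.
move=> cov [_ [u [W [[uvS WT0 Wk vW] [ur noS]]]]].
have [Q [RQ sQ] Qacc] := cov _ (admissible_reached_region WT0 noS Wk).
have Qu : Q (copy 0 (code u)) by apply: RQ; rewrite /reached_region regionE //=; apply/reachedP.
have Qt : ~~ Q (copy 3 (code v)) by apply: sQ; rewrite keys_marked map_f ?code_codes.
have [Qv|Qv] := boolP (Q (copy 2 (code v))).
  by apply: (Qacc _ (copy 3 (code v))) Qv Qt; apply/mem_network; constructor.
by apply: (Qacc _ (copy 2 (code v))) Qu Qv; apply/mem_network; apply: (ArcS uvS).
Qed.

End Digraph.

(** * Running time *)

Section Growth.

Variables (N k : nat).
Hypotheses (N_gt0 : 0 < N) (k_gt0 : 0 < k).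

(** The class of bounds hidden by the O-star notation, with explicit exponents. *)
Definition grows (a d x : nat) : Prop := x <= 2 ^ (a * k) * N ^ d.

Lemma grows_weaken a d a' d' x : a <= a' -> d <= d' -> grows a d x -> grows a' d' x.
Proof.
move=> le_a le_d /leq_trans; apply; apply: leq_mul; last by rewrite leq_pexp2l.
by rewrite leq_exp2l // leq_mul2r le_a orbT.
Qed.

Lemma grows_le a d x y : x <= y -> grows a d y -> grows a d x.
Proof. exact: leq_trans. Qed.

(** As [k] is positive, constants are absorbed into the exponent: [c <= 2 ^ c <= 2 ^ (c * k)]. *)
Lemma grows_const c : grows c 0 c.
Proof.
rewrite /grows expn0 muln1; apply: leq_trans (ltnW (ltn_expl c (ltnSn 1))) _.
by rewrite leq_exp2l // leq_pmulr.
Qed.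

Lemma grows_N : grows 0 1 N.
Proof. by rewrite /grows mul0n mul1n expn1. Qed.

Lemma grows_k : grows 1 0 k.
Proof. by rewrite /grows expn0 muln1 mul1n ltnW // ltn_expl. Qed.

Lemma grows_exp a : grows a 0 (2 ^ (a * k)).
Proof. by rewrite /grows muln1. Qed.

Lemma grows_mul a d a' d' x y :
  grows a d x -> grows a' d' y -> grows (a + a') (d + d') (x * y).
Proof.
move=> gx gy; apply: leq_trans (leq_mul gx gy) _.
by rewrite mulnDl !expnD mulnACA.
Qed.

Lemma grows_add a d a' d' x y :
  grows a d x -> grows a' d' y -> grows (a + a').+1 (d + d') (x + y).
Proof.
move=> /(grows_weaken (leq_addr a' a) (leq_addr d' d)) gx.
move=> /(grows_weaken (leq_addl a a') (leq_addl d d')) gy.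
apply: leq_trans (leq_add gx gy) _.
rewrite addnn -mul2n mulnA -expnS; apply: leq_mul => //.
by rewrite leq_exp2l // mulSn -add1n leq_add2r.
Qed.

Lemma grows_succ a d x : grows a d x -> grows (a + 1).+1 (d + 0) x.+1.
Proof. by move=> gx; rewrite -[x.+1]addn1; apply: grows_add gx (grows_const 1). Qed.

End Growth.

(** Closed form of the recurrence, written additively to avoid truncated subtraction. *)
Lemma branch_calls_eq (U : seq tree) c :
  branch_calls U c + 2 * (size U).+1 = (size U).+1 * 2 ^ c.+1.
Proof.
elim: c => [|c IH] /=; first by rewrite mulnC.
by rewrite expnS mulnCA -IH; lia.
Qed.

Lemma calls_le (U : seq tree) s c : calls U s c <= (size U).+1 * 2 ^ c.+1.
Proof. by rewrite -branch_calls_eq /calls; lia. Qed.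

(** [2 * n + 9] bounds the size of a node, [e + s + 2 * n] is the number of arcs, and the second
    [n.+1] term allows for the encoding of [T0]. *)
Definition total_cost (U : seq tree) (n e s k : nat) : nat :=
  40 * e.+1 + 40 * s.+1 + 100 * n.+1 + 40 * n.+1 + 20 * k.+1 + 200
  + step_cost U (2 * n + 9) (e + s + 2 * n) * ((size U).+1 * 2 ^ (2 * k + 2 * k).+1).

Lemma total_cost_bound : exists a d, forall (U : seq tree) n e s k,
  size U = 4 * n -> 0 < n -> s <= e -> 0 < k ->
  total_cost U n e s k <= 2 ^ (a * k) * (n + e) ^ d.
Proof.
(* The two exponents stay open and are filled in by unification as the rules for [grows] follow the
   shape of the cost. *)
eexists; eexists=> U n e s k sU n_gt0 le_se k_gt0.
have N_gt0 : 0 < n + e by rewrite addn_gt0 n_gt0.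
have gN := grows_N (n + e) k.
have gn := grows_le (leq_addr e n) gN.
have ge := grows_le (leq_addl n e) gN.
have gs := grows_le le_se ge.
(* The exponent [4 * k + 1] is at most [5 * k]. *)
have gp : grows (n + e) k 5 0 (2 ^ (2 * k + 2 * k).+1).
  apply: grows_le (grows_exp (n + e) k 5); rewrite leq_exp2l //; lia.
rewrite -/(grows (n + e) k _ _ _) /total_cost /step_cost /search_cost /pick_cost.
rewrite /out_cost /ext_cost /swap_cost /lookup_cost sU.
repeat lazymatch goal with
  | |- grows _ _ _ _ (_ + _) => eapply (grows_add N_gt0 k_gt0)
  | |- grows _ _ _ _ (_ * _) => eapply grows_mul
  | |- grows _ _ _ _ (2 ^ _) => exact: gp
  | |- grows _ _ _ _ ?x =>
      first [ is_var x; first [ eassumption | apply: grows_k ]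
            | match x with context [?y] => is_var y end;
              eapply (grows_succ N_gt0 k_gt0)
            | apply: (grows_const _ k_gt0) ]
  end.
Qed.

(** * From the computed list of codes to the set of vertices *)

Lemma subset_codes (V : finType) (acc : seq tree) :
  {subset acc <= codes #|V|} -> exists s : seq V, acc = [seq enc_vertex x | x <- s].
Proof.
elim: acc => [|a acc IH] sub; first by exists [::].
have [|s ->] := IH; first by move=> b b_acc; apply: sub; rewrite inE b_acc orbT.
by have [x ->] := codes_code (sub _ (mem_head _ _)); exists (x :: s).
Qed.

Theorem theorem8 :
  exists (P : program) (a b d : nat),
  forall (V : finType) (E S : {set V * V}) (k : nat) (T0 : {set V}),
    S \subset E -> 0 < k -> T0 != set0 ->
    exists (F : {set V}) (y : tree) (t : nat),
      [/\ runs P (enc_input E S k T0) y t,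
          represents y F,
          t <= 2 ^ (a * k) * (#|V| + #|E|) ^ d,
          #|F| <= 2 ^ (b * k)
        & forall v : V, critical E S T0 k v -> v \in F].
Proof.
have [a [d total]] := total_cost_bound.
(* The 6 comes from [2 * k * 2 ^ (4 * k)], the bound on the list for both budgets equal to [2 * k],
   with [2 * k] at most [2 ^ (2 * k)]. *)
exists prog, a, 6, d => V E S k T0 SE k_gt0 T0_neq0.
have V_gt0 : 0 < #|V|.
  by have /set0Pn[x _] := T0_neq0; apply/card_gt0P; exists x.
have leXU : size (codes #|V|) <= size (nodes V) by rewrite size_codes size_nodes; lia.
have X_size a' : a' \in codes #|V| -> tree_size a' <= 2 * #|V| + 9.
  by case/mem_codes=> i lt_i ->; rewrite tree_size_enc_nat; lia.
have [|acc Hgo [uacc accX _ sacc cov]] := @go_spec (nodes V) (codes #|V|)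
  (2 * #|V| + 9) (#|E| + #|S| + 2 * #|V|) (2 * k) (digraph_network E S) (keys (sinks V))
  (@tree_size_nodes V) X_size leXU (@net_network V E S) (@labelled_network V E S)
  false (sources T0) (sinks V) (digraph_network E S) (2 * k) (2 * k) [::]
  (state_init E S T0 (2 * k)) isT; first by [].
have [t le_t run_t] := @main_computes #|V| [seq enc_arc e | e <- enum E]
  [seq enc_arc e | e <- enum S] k [seq enc_vertex x | x <- enum T0] _ _ Hgo.
have [s accE] := subset_codes accX; subst acc.
have us : uniq s := map_uniq uacc.
exists [set v in s], (enc_trees [seq enc_vertex x | x <- s]), t; split.
- by move: run_t; rewrite !enc_seq_map.
- exists s; split=> //; first by move=> v; rewrite inE.
  by rewrite enc_seq_map.
- apply: leq_trans le_t (leq_trans _ (total (nodes V) _ _ #|S| _ _ _ _ _)) => //.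
  + rewrite /total_cost !size_map -!cardE leq_add //.
      by rewrite !leq_add2r leq_add2l leq_mul2l ltnS max_card orbT.
    by rewrite leq_mul2l calls_le orbT.
  + exact: size_nodes.
  + exact: subset_leq_card.
- rewrite cardsE (card_uniqP us); rewrite size_map /= add0n in sacc.
  apply: leq_trans sacc _; have -> : 6 * k = 2 * k + (2 * k + 2 * k) by lia.
  by rewrite [2 ^ (_ + (_ + _))]expnD leq_mul2r (ltnW (ltn_expl _ _)) ?orbT.
- move=> v /(critical_covered cov); rewrite inE mem_map //; exact: code_inj.
Qed.
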